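(* For each real $m>0$ there exists a constant $\mathrm{const}(m)$, depending only on $m$, such that the following holds. Let $M^n$ be a closed connected $n$-dimensional topological submanifold of an $(n+1)$-dimensional Banach space $B^{n+1}$, and let $\Omega$ denote the closure of the bounded connected component of $B^{n+1}\setminus M^n$. Then $$\mathrm{HC}_{m+1}(\Omega)\le \mathrm{const}(m)\,\mathrm{HC}_m(M^n)^{\frac{m+1}{m}}.$$
   Context: For a real $m>0$ and a subset $V$ of a metric space $Z$ (here $Z=B^{n+1}$), the $m$-dimensional Hausdorff content $\mathrm{HC}_m(V)$ is the infimum of $\sum_i r_i^m$ over all coverings of $V$ by countably many closed metric balls $B(x_i,r_i)$ in $Z$. A closed manifold is a compact manifold without boundary. *)

(* Defs.v *)
From HB Require Import structures.
From mathcomp Require Import all_boot all_order all_algebra.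
From mathcomp Require Import all_classical all_reals all_analysis.
Set Implicit Arguments.
Unset Strict Implicit.
Unset Printing Implicit Defensive.
Import Order.TTheory GRing.Theory Num.Theory.
Import numFieldNormedType.Exports.
Local Open Scope classical_set_scope.
Local Open Scope ring_scope.

(* The balls are [closed_ball_ Num.norm c r], as [closed_ball c 0] is empty.
   Radius 0 is allowed, so that finite coverings extend to sequences without
   changing the sum (0 `^ m = 0 for m > 0). *)
Definition hausdorff_content (R : realType) (B : normedModType R) (m : R)
    (V : set B) : \bar R :=
  ereal_inf [set s : \bar R | exists (c : nat -> B) (r : nat -> R),
    [/\ forall i, 0 <= r i,
        V `<=` \bigcup_i closed_ball_ Num.norm (c i) (r i) &
        s = (\sum_(0 <= i <oo) (r i `^ m)%:E)%E]].

Definition homeomorphic_sets (X Y : topologicalType) (A : set X) (W : set Y) :=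
  exists (f : X -> Y) (g : Y -> X),
    [/\ {homo f : x / A x >-> W x} /\ {homo g : y / W y >-> A y},
        forall x, A x -> g (f x) = x,
        forall y, W y -> f (g y) = y,
        {within A, continuous f} & {within W, continuous g}].

(* M, with the topology induced by X, is a topological n-manifold without
   boundary.  No local flatness is required, and X is meant to be a
   finite-dimensional normed space, where every subset is Hausdorff and
   second countable. *)
Definition topological_submanifold (R : realType) (n : nat)
    (X : topologicalType) (M : set X) :=
  forall p, M p -> exists (U : set X) (W : set 'rV[R]_n),
    [/\ open U, U p, open W & homeomorphic_sets (M `&` U) W].

Definition is_component (X : topologicalType) (A U : set X) :=
  exists2 x, A x & U = connected_component A x.

(* Main.v *)
Require Import Defs.
From HB Require Import structures.
From mathcomp Require Import all_boot all_order all_algebra.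
From mathcomp Require Import all_classical all_reals all_analysis.
From mathcomp Require Import ring lra zify.
Import Order.TTheory GRing.Theory Num.Theory.
Import numFieldNormedType.Exports.
Local Open Scope classical_set_scope.
Local Open Scope ring_scope.

(** The constant comes from a boxing inequality: when m <= k <= n, a bounded
    component U of the complement of a compact set M in a normed space of
    dimension n + 1 satisfies HC_m(U) <= C HC_m(M), where C depends on m and k
    alone.  Taking for k the ceiling of m, the isoperimetric inequality
    follows, because the sum of the rho_j^(m+1) is at most the power
    (m + 1) / m of the sum of the rho_j^m ([sum_powR_add1_le]).  If the ceiling
    of m exceeds n, then m + 1 exceeds the dimension of the space and every
    bounded set has vanishing content ([bounded_null_cover]).

    For the boxing inequality, cover M by finitely many balls B(c_i, r_i).  The
    heart of the matter is [trapped_point_density]: around every x in U there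
    is a radius rho such that the balls of the covering that meet B(x, rho)
    carry mass, sum of r_i^m, more than eps rho^m.  Given this, a Vitali
    selection among the balls B(x, rho), together with the balls B(c_i, 2 r_i)
    for the points where some r_i is larger than rho, covers U at the expense
    of a factor 2^m + 5^m / eps ([greedy_ball_cover], [boxing]).

    The density statement is where the dimension disappears: it concerns one
    point x, so it may be proved inside any affine subspace through x.  A
    subspace of dimension k + 1 is used; there, vectors produced by Riesz's
    lemma give coordinates whose distortion depends on k only
    ([frame_exists]).  Suppose that the covering is sparse at all scales around
    x, and consider the cubes with corner x that contain N^(k+1) points of a
    fine grid, N a power of 2.  A ball of radius r meets about (r / eta)^k lines
    of the grid of mesh eta in each direction, and since m <= k and the radii
    that matter are at most the scale, sparseness in dimension m implies that
    only a small proportion of the lines in each cube meets the covering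
    ([few_bad_lines]).  The grid points that belong to U can be left along bad
    lines only.  A combinatorial isoperimetric inequality
    ([grid_isoperimetry]) then shows that if they form half of a cube, which is
    a fixed proportion of the next one, they also form half of the next one
    ([majority_propagates]).  This starts at x itself and never stops, so
    U is unbounded. *)

Set Implicit Arguments.
Unset Strict Implicit.
Unset Printing Implicit Defensive.

(** * Isoperimetry in a finite grid *)
Definition splice (d : nat) (T : Type) (j : nat) (p q : {ffun 'I_d -> T}) :=
  [ffun l : 'I_d => if (l < j)%N then q l else p l].

Lemma spliceK (d : nat) (T : Type) (j : nat) (p q : {ffun 'I_d -> T}) :
  splice j (splice j p q) (splice j q p) = p.
Proof. by apply/ffunP => l; rewrite !ffunE; case: (ltnP l j). Qed.

(** Exchanging the first j coordinates of p and q is an involution on pairs, so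
    a spliced point is uniformly distributed when (p, q) is. *)
Lemma card_splice_preim (d : nat) (T : finType) (j : nat)
    (S : {set {ffun 'I_d -> T}}) :
  (#|[set pq : {ffun 'I_d -> T} * {ffun 'I_d -> T} |
       splice j pq.1 pq.2 \in S]%SET| <= #|S| * #|{ffun 'I_d -> T}|)%N.
Proof.
pose f (pq : {ffun 'I_d -> T} * {ffun 'I_d -> T}) :=
  (splice j pq.1 pq.2, splice j pq.2 pq.1).
have fK : cancel f f by case=> p q; rewrite /f /= !spliceK.
rewrite -cardsT -cardsX -(card_imset _ (can_inj fK)).
apply/subset_leq_card/fintype.subsetP => _ /imsetP[[p q] + ->].
by rewrite !inE andbT.
Qed.

(** Changing the coordinates of p one at a time into those of q gives the path
    p = splice 0 p q, ..., splice d p q = q, which must leave G somewhere. *)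
Lemma splice_escape (d : nat) (T : finType)
    (G : {set {ffun 'I_d -> T}}) (bad : 'I_d -> {set {ffun 'I_d -> T}})
    (p q : {ffun 'I_d -> T}) :
  (forall j (u v : {ffun 'I_d -> T}), u \in G -> u \notin bad j ->
     (forall l, l != j -> v l = u l) -> v \in G) ->
  p \in G -> q \notin G -> exists j : 'I_d, splice j p q \in bad j.
Proof.
move=> Gcl pG qG; apply/existsP; apply: contraNT qG => /existsPn nobad.
have sG j : (j <= d)%N -> splice j p q \in G.
  elim: j => [|j IH] jd.
    by rewrite (_ : splice _ _ _ = p) //; apply/ffunP => l; rewrite ffunE.
  apply: (Gcl (Ordinal jd) _ _ (IH (ltnW jd)) (nobad (Ordinal jd))) => l lj.
  rewrite !ffunE ltnS leq_eqVlt.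
  by have /negbTE -> : nat_of_ord l != j by [].
rewrite (_ : q = splice d p q) ?sG //.
by apply/ffunP => l; rewrite ffunE ltn_ord.
Qed.

(** Here [bad j] is meant to be the union of the forbidden lines in direction
    j.  Each pair in G x ~G is charged to a bad point of its coordinate path,
    and a bad point is charged at most as many times as there are points. *)
Lemma grid_isoperimetry (d : nat) (T : finType)
    (G : {set {ffun 'I_d -> T}}) (bad : 'I_d -> {set {ffun 'I_d -> T}}) :
  (forall j (u v : {ffun 'I_d -> T}), u \in G -> u \notin bad j ->
     (forall l, l != j -> v l = u l) -> v \in G) ->
  (#|G| * #|~: G| <= (\sum_j #|bad j|) * #|{ffun 'I_d -> T}|)%N.
Proof.
move=> Gcl; rewrite -cardsX big_distrl /=.
pose F (j : 'I_d) := [set pq : {ffun 'I_d -> T} * {ffun 'I_d -> T} |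
       splice j pq.1 pq.2 \in bad j]%SET.
apply: (@leq_trans (\sum_j #|F j|)); last first.
  by apply: leq_sum => j _; exact: card_splice_preim.
apply: (@leq_trans #|(\bigcup_j F j)%SET|); last first.
  elim/big_rec2: _ => [|j x A _ le]; first by rewrite cards0.
  exact: leq_trans (leq_card_setU _ _) (leq_add _ _).
apply/subset_leq_card/fintype.subsetP => -[p q].
rewrite !inE /= => /andP[pG qG].
have [j jb] := splice_escape Gcl pG qG.
by apply/bigcupP; exists j; rewrite ?inE.
Qed.

Lemma card_near_ord (N D : nat) (b : 'I_N) :
  (#|[set a : 'I_N | (a <= b + D) && (b <= a + D)]%N%SET| <= 2 * D + 1)%N.
Proof.
rewrite -[X in (_ <= X)%N]card_ord -cardsT addn1.
pose f (a : 'I_N) : 'I_(2 * D).+1 := inord (a + D - b).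
rewrite -(@card_in_imset _ _ f).
  by apply/subset_leq_card/fintype.subsetP => ? _; rewrite inE.
move=> a a'; rewrite !inE => /andP[h1 h2] /andP[h3 h4] /(congr1 val) /=.
rewrite !inordK; try lia.
by move=> h; apply/val_inj => /=; lia.
Qed.

(** A set whose coordinates other than the j-th vary by at most D lies in a
    bundle of at most (2 D + 1)^(d - 1) lines of direction j. *)
Lemma card_grid_line (d N D : nat) (j : 'I_d) (S : {set {ffun 'I_d -> 'I_N}}) :
  (forall u u' l, u \in S -> u' \in S -> l != j -> (u l <= u' l + D)%N) ->
  (#|S| <= N * (2 * D + 1) ^ d.-1)%N.
Proof.
move=> near; have [->|[u0 u0S]] := set_0Vmem S; first by rewrite cards0.
pose F (l : 'I_d) : {set 'I_N} := if l == j then [set: 'I_N]%SET else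
  [set a : 'I_N | (a <= u0 l + D) && (u0 l <= a + D)]%N%SET.
apply: (@leq_trans #|family F|).
  apply/subset_leq_card/fintype.subsetP => u uS; apply/familyP => l; rewrite /F.
  case: ifPn => lj; rewrite ?in_setT ?inE //.
  by apply/andP; split; apply: near.
rewrite card_family foldrE big_image /= (bigD1 j) //=.
rewrite {1}/F eqxx cardsT card_ord.
rewrite leq_mul2l; apply/orP; right.
apply: (@leq_trans (\prod_(l < d | l != j) (2 * D + 1))%N).
  apply: leq_prod => l /negbTE lj; rewrite /F lj; exact: card_near_ord.
by rewrite prod_nat_const cardC1 card_ord.
Qed.

(** The proportion 2^-(d+1) is what half of a cube of side N / 2 represents in
    the cube of side N. *)
Lemma majority_propagates (d N : nat) (G : {set {ffun 'I_d -> 'I_N}})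
    (bad : 'I_d -> {set {ffun 'I_d -> 'I_N}}) :
  (forall j (u v : {ffun 'I_d -> 'I_N}), u \in G -> u \notin bad j ->
     (forall l, l != j -> v l = u l) -> v \in G) ->
  (2 ^ d.+2 * \sum_j #|bad j| <= N ^ d)%N ->
  (N ^ d <= 2 ^ d.+1 * #|G|)%N -> (N ^ d <= 2 * #|G|)%N.
Proof.
move=> Gcl few half; have := grid_isoperimetry Gcl.
rewrite card_ffun !card_ord; have := cardsC G; rewrite card_ffun !card_ord.
set a := #|G| in half *; set b := #|~: G|; set X := (N ^ d)%N in few half *.
set s := (\sum_j _)%N in few * => abX iso.
have h1 : (2 ^ d.+2 * (a * b) <= X * X)%N.
  apply: leq_trans (leq_mul (leqnn (2 ^ d.+2)) iso) _.
  by rewrite mulnA leq_mul2r few orbT.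
have h2 : (X * (2 * b) <= X * X)%N.
  apply: leq_trans h1; rewrite (expnS 2 d.+1).
  rewrite [leqRHS](_ : _ = (2 ^ d.+1 * a) * (2 * b))%N; last by ring.
  by rewrite leq_mul2r half orbT.
have [X0|X0] := posnP X; first by rewrite X0.
move: h2; rewrite leq_pmul2l // => h2; lia.
Qed.

Lemma card_grid_widen (d N N' : nat) (G : {set {ffun 'I_d -> 'I_N}})
    (G' : {set {ffun 'I_d -> 'I_N'}}) (NN' : (N <= N')%N) :
  (forall z, z \in G -> [ffun l => widen_ord NN' (z l)] \in G') ->
  (#|G| <= #|G'|)%N.
Proof.
move=> GG'; pose f (z : {ffun 'I_d -> 'I_N}) := [ffun l => widen_ord NN' (z l)].
have finj : injective f.
  move=> z z' /ffunP fz; apply/ffunP => l; have := fz l.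
  by rewrite !ffunE => /(congr1 val) /= /val_inj.
rewrite -(card_imset _ finj).
apply/subset_leq_card/fintype.subsetP => _ /imsetP[z zG ->].
exact: GG'.
Qed.

(** * Frames with bounded coordinates *)
Section Frames.
Variables (R : realType) (B : normedModType R).
Implicit Types (d : nat).

Definition lincomb d (e : 'I_d -> B) (t : 'I_d -> R) : B :=
  \sum_l t l *: e l.

Definition coord_bounded d (e : 'I_d -> B) (A : R) :=
  forall t l, `|t l| <= A * `|lincomb e t|.

Lemma lincombD d (e : 'I_d -> B) t u :
  lincomb e (fun l => t l + u l) = lincomb e t + lincomb e u.
Proof.
by rewrite /lincomb -big_split; apply: eq_bigr => l _; rewrite scalerDl.
Qed.

Lemma lincombB d (e : 'I_d -> B) t u :
  lincomb e (fun l => t l - u l) = lincomb e t - lincomb e u.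
Proof.
by rewrite /lincomb -sumrB; apply: eq_bigr => l _; rewrite scalerBl.
Qed.

Lemma lincombZ d (e : 'I_d -> B) a t :
  lincomb e (fun l => a * t l) = a *: lincomb e t.
Proof.
by rewrite /lincomb scaler_sumr; apply: eq_bigr => l _; rewrite scalerA.
Qed.

Lemma norm_lincomb_le d (e : 'I_d -> B) t K :
  (forall l, `|e l| <= 1) -> (forall l, `|t l| <= K) ->
  `|lincomb e t| <= d%:R * K.
Proof.
move=> e1 tK; apply: le_trans (ler_norm_sum _ _ _) _.
rewrite mulr_natl -[in leRHS](card_ord d) -sumr_const; apply: ler_sum => l _.
by rewrite normrZ -[leRHS]mulr1; apply: ler_pM.
Qed.

(** The span of a frame with bounded coordinates is closed: the coordinates of
    better and better approximations of v form nested intervals, whose common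
    point gives the coordinates of v itself. *)
Lemma lincomb_dist_gt0 d (e : 'I_d -> B) A v :
  (forall l, `|e l| <= 1) -> coord_bounded e A ->
  (forall t, v <> lincomb e t) ->
  exists2 del : R, 0 < del & forall t, del <= `|v - lincomb e t|.
Proof.
move=> e1 eA vNe; apply: contrapT => far.
have near (eps : R) : 0 < eps -> exists t, `|v - lincomb e t| <= eps.
  move=> e0; apply: contrapT => h; apply: far; exists eps => // t.
  by rewrite leNgt; apply/negP => /ltW lt; apply: h; exists t.
(* The lower ends of the intervals that contain the limit coordinate. *)
pose S l := [set s | exists t eps,
  `|v - lincomb e t| <= eps /\ s = t l - A * eps].
have A0 (l : 'I_d) : 0 <= A.
  have := eA (fun=> 1) l; rewrite normr1 => h; rewrite leNgt; apply/negP => A0.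
  have : A * `|lincomb e (fun=> 1)| <= 0 by rewrite nmulr_rle0.
  by move=> h'; have := le_trans h h'; rewrite ler10.
have cross l t eps t' eps' : `|v - lincomb e t| <= eps ->
    `|v - lincomb e t'| <= eps' -> t l - A * eps <= t' l + A * eps'.
  move=> h h'; have : `|t l - t' l| <= A * (eps + eps').
    apply: le_trans (eA (fun l => t l - t' l) l) _.
    rewrite lincombB ler_wpM2l ?(A0 l) //.
    rewrite -[lincomb e t - _](subrKA v) addrC [leRHS]addrC.
    by apply: le_trans (ler_normD _ _) _; rewrite lerD // distrC.
  by rewrite ler_norml => /andP[_]; rewrite mulrDr; clear A0; lra.
pose T l := sup (S l).
have TP l t eps : `|v - lincomb e t| <= eps -> `|t l - T l| <= A * eps.
  move=> h; rewrite distrC ler_distl; apply/andP; split.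
    by apply: ub_le_sup; [exists (t l + A * eps) => _ [t' [eps' [h' ->]]];
      exact: cross h' h|exists t, eps].
  apply: ge_sup; first by exists (t l - A * eps), t, eps.
  by move=> _ [t' [eps' [h' ->]]]; exact: cross h' h.
apply: (vNe T); apply/eqP; rewrite -subr_eq0 -normr_le0.
apply/ler_addgt0Pl => _/posnumP[r]; rewrite addr0.
have K0 : 0 < 1 + d%:R * `|A| :> R by rewrite ltr_pwDl // mulr_ge0.
have [t tr] := near (r%:num / (1 + d%:R * `|A|)) ltac:(by rewrite divr_gt0).
rewrite -[v - _](subrKA (lincomb e t)) -lincombB.
apply: le_trans (ler_normD _ _) _.
rewrite -[leRHS](@divfK _ (1 + d%:R * `|A|)) ?gt_eqF // mulrDr mulr1 lerD //.
rewrite mulrCA; apply: norm_lincomb_le => // l.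
apply: le_trans (TP l _ _ tr) _; by rewrite mulrC ler_wpM2l ?ler_norm.
Qed.

(** Riesz's lemma; 1 / 2 stands for any number below 1, so that no point of the
    span has to realize the distance to v. *)
Lemma riesz_vector d (e : 'I_d -> B) A v :
  (forall l, `|e l| <= 1) -> coord_bounded e A ->
  (forall t, v <> lincomb e t) ->
  exists2 w, `|w| = 1 & forall t, 2^-1 <= `|w - lincomb e t|.
Proof.
move=> e1 eA vNe; have [del del0 delP] := lincomb_dist_gt0 e1 eA vNe.
pose S := [set `|v - lincomb e t| | t in setT].
have S0 : S !=set0 by exists `|v - lincomb e (fun=> 0)|, (fun=> 0).
have lbS : lbound S 0 by move=> _ [t _ <-].
have hinf : has_inf S by split => //; exists 0.
have i0 : 0 < inf S.
  apply: lt_le_trans del0 _; apply: lb_le_inf => // _ [t _ <-]; exact: delP.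
have [_ [t0 _ <-]] : exists2 x, S x & x < inf S + inf S.
  by apply: inf_adherent.
set u := v - _ => u2.
have u0 : 0 < `|u|.
  by rewrite (lt_le_trans del0) // delP.
exists (`|u|^-1 *: u); first by rewrite normrZ normfV normr_id mulVf ?gt_eqF.
move=> t.
have -> : `|u|^-1 *: u - lincomb e t =
    `|u|^-1 *: (v - lincomb e (fun l => t0 l - (- `|u|) * t l)).
  rewrite lincombB lincombZ scaleNr opprK opprD addrA -/u [RHS]scalerBr.
  by rewrite scalerA mulVf ?gt_eqF // scale1r.
rewrite normrZ normfV normr_id mulrC ler_pdivlMr //.
have := delP (fun l => t0 l - (- `|u|) * t l).
set x := `|v - _| => _.
have : inf S <= x.
  apply: ge_inf; first by exists 0.
  by exists (fun l => t0 l - (- `|u|) * t l).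
lra.
Qed.

Lemma coord_bounded_extend d (e : 'I_d -> B) A w :
  1 <= A -> coord_bounded e A -> `|w| = 1 ->
  (forall t, 2^-1 <= `|w - lincomb e t|) ->
  coord_bounded (fun l => oapp e w (unlift ord0 l)) (3 * A).
Proof.
move=> A1 eA w1 wfar t; set y := lincomb _ t.
have yE : y = t ord0 *: w + lincomb e (fun l => t (lift ord0 l)).
  rewrite /y /lincomb big_ord_recl unlift_none /=; congr (_ + _).
  by apply: eq_bigr => l _; rewrite liftK.
have t0y : `|t ord0| <= 2 * `|y|.
  have [->|t0] := eqVneq (t ord0) 0; first by rewrite normr0 mulr_ge0.
  have -> : y = t ord0 *:
      (w - lincomb e (fun l => - (t ord0)^-1 * t (lift ord0 l))).
    by rewrite yE lincombZ scalerBr scalerA mulrN divff // scaleN1r opprK.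
  rewrite normrZ mulrCA ler_peMr //.
  by have := wfar (fun l => - (t ord0)^-1 * t (lift ord0 l)); lra.
move=> l; case: (unliftP ord0 l) => [j ->|->]; last first.
  by apply: le_trans t0y _; rewrite ler_wpM2r //; lra.
apply: le_trans (eA (fun l => t (lift ord0 l)) j) _.
rewrite [3 * A]mulrC -mulrA ler_wpM2l //; first by lra.
have -> : lincomb e (fun l => t (lift ord0 l)) = y - t ord0 *: w.
  by rewrite yE addrAC subrr add0r.
apply: le_trans (ler_normB _ _) _; rewrite normrZ w1 mulr1; lra.
Qed.

Lemma lincomb_coords n (v2r : B -> 'rV[R]_n) d (e : 'I_d -> B) t :
  linear v2r ->
  v2r (lincomb e t) = (\row_l t l) *m \matrix_l v2r (e l).
Proof.
move=> lin; rewrite mulmx_sum_row /lincomb.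
have v0 : v2r 0 = 0.
  by have := lin (-1) 0 0; rewrite scaler0 addr0 scaleN1r addNr.
elim/big_rec2: _ => // l _ x _ <-.
by rewrite lin rowK mxE.
Qed.

(** The bound depends on the number d of vectors but neither on the dimension
    of the space nor on its norm. *)
Lemma frame_exists n (dimB : Vector.axiom n B) d : (d <= n)%N ->
  exists2 e : 'I_d -> B, forall l, `|e l| <= 1 & coord_bounded e (3 ^+ d).
Proof.
case: dimB => v2r lin [r2v v2rK r2vK].
elim: d => [_|d IH dn]; first by exists (fun=> 0) => [l|t []//]; rewrite normr0.
have [e e1 eA] := IH (ltnW dn).
pose E := \matrix_l v2r (e l).
have [i iE] : exists i, ~~ (row i (1%:M : 'M[R]_n) <= E)%MS.
  apply/existsP; rewrite -negb_forall; apply/negP => /forallP h.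
  have /mxrankS : (1%:M <= E)%MS by apply/row_subP.
  by rewrite mxrank1 leqNgt (leq_ltn_trans (rank_leq_row _)).
have [w w1 wfar] : exists2 w, `|w| = 1 & forall t, 2^-1 <= `|w - lincomb e t|.
  apply: (riesz_vector (v := r2v (row i 1%:M)) e1 eA) => t vE.
  move/negP: iE; apply; rewrite -(r2vK (row i _)) vE lincomb_coords //.
  exact: submxMl.
exists (fun l => oapp e w (unlift ord0 l)).
  by move=> l; case: (unlift ord0 l) => [j|] /=; rewrite ?w1.
rewrite exprS; apply: coord_bounded_extend => //.
by rewrite exprn_ege1 // ler1n.
Qed.

Lemma frame_spans n (dimB : Vector.axiom n B) (e : 'I_n -> B) A :
  coord_bounded e A -> forall v, exists t, v = lincomb e t.
Proof.
case: dimB => v2r lin [r2v v2rK r2vK] eA v.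
pose E := \matrix_l v2r (e l).
have injE : row_free E.
  rewrite -kermx_eq0.
  apply/rowV0P => u /sub_kermxP uE.
  have u0 : lincomb e (fun l => u ord0 l) = 0.
    have v0 : v2r 0 = 0.
      by have := lin (-1) 0 0; rewrite scaler0 addr0 scaleN1r addNr.
    apply: (can_inj v2rK); rewrite lincomb_coords // v0 -[RHS]uE.
    congr (_ *m _).
    by apply/rowP => l; rewrite mxE.
  apply/rowP => l; apply/eqP; rewrite mxE -normr_le0.
  by have := eA (fun l => u ord0 l) l; rewrite u0 normr0 mulr0.
have : (v2r v <= E)%MS.
  by apply: submx_full; rewrite row_full_unit -row_free_unit.
case/submxP => u uE; exists (fun l => u ord0 l).
apply: (can_inj v2rK); rewrite lincomb_coords // uE; congr (_ *m _).
by apply/rowP => l; rewrite mxE.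
Qed.

End Frames.

(** * Trapped points see a dense covering *)
Lemma component_segment (R : realType) (B : normedModType R) (M U : set B) p q :
  is_component (~` M) U -> U p ->
  (forall s : R, 0 <= s <= 1 -> ~ M (p + s *: (q - p))) -> U q.
Proof.
move=> [x0 Ax0 ->] Up seg.
pose f s := p + s *: (q - p).
apply: connected_component_trans Up _; exists (f @` `[0, 1]); last first.
  by exists 1; rewrite /f /= ?in_itv /= ?ler01 ?lexx // scale1r addrC subrK.
split.
- by exists 0; rewrite /f /= ?in_itv /= ?ler01 ?lexx // scale0r addr0.
- by move=> _ [s s01 <-]; apply: seg; move: s01; rewrite /= in_itv.
- apply: connected_continuous_connected; first exact: segment_connected.
  apply: continuous_subspaceT => s.
  by apply: cvgD; [exact: cvg_cst|exact: scalel_continuous].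
Qed.

(** A density that is small enough for [few_bad_lines]: 3^(k+1) is the
    distortion of the coordinates of a frame of k + 1 vectors, and 2^(k+3) the
    factor required by [majority_propagates]. *)
Definition sparseness (R : realType) (k : nat) : R :=
  (k.+1%:R * 2 ^+ k.+3 * (5 * 3 ^+ k.+1 * k.+1%:R) ^+ k)^-1.

Lemma sparseness_gt0 (R : realType) k : 0 < sparseness R k.
Proof. by rewrite /sparseness invr_gt0 ?(exprn_gt0, mulr_gt0, ltr0n). Qed.

Lemma sparseness_le1 (R : realType) k : sparseness R k <= 1.
Proof.
have p3 : 1 <= 3 ^+ k.+1 :> R by rewrite exprn_ege1 // ler1n.
have k1 : 1 <= k.+1%:R :> R by rewrite ler1n.
rewrite /sparseness invf_le1; last by rewrite ?(exprn_gt0, mulr_gt0, ltr0n).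
apply: mulr_ege1; first by rewrite mulr_ege1 // exprn_ege1 // ler1n.
by rewrite exprn_ege1 // !mulr_ege1 // ler1n.
Qed.

Lemma leq_add_truncn (R : realType) (a b : nat) (z : R) :
  `|a%:R - b%:R| <= z -> (a <= b + Num.truncn z)%N.
Proof.
move=> abz; have z0 : 0 <= z by apply: le_trans abz.
rewrite -leq_subLR; case: (leqP a b) => [|ba].
  by rewrite -subn_eq0 => /eqP ->.
rewrite truncn_ge_nat // natrB 1?ltnW //.
exact: le_trans (ler_norm _) abz.
Qed.

Section Grid.
Variables (R : realType) (B : normedModType R) (k : nat) (m : R).
Variables (I : finType) (c : I -> B) (r : I -> R).
Variables (e : 'I_k.+1 -> B) (x : B) (eta : R).
Hypotheses (m0 : 0 < m) (mk : m <= k%:R).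
Hypotheses (eta0 : 0 < eta) (eta_r : forall i, eta <= r i).
Hypotheses (e1 : forall l, `|e l| <= 1) (eA : coord_bounded e (3 ^+ k.+1)).
Hypothesis sparse : forall rho : R, 0 < rho ->
  \sum_(i | `|x - c i| <= rho + r i) r i `^ m <= sparseness R k * rho `^ m.

(** The grid has mesh [eta] and its corner at [x]; [eta] is at most the
    least radius, which lets the constants absorb the rounding of counts. *)
Definition gridpt (t : 'I_k.+1 -> R) := x + eta *: lincomb e t.

(** The whole segment of the line that lies in the cube of side N has to avoid
    the ball, whence the real parameter s. *)
Definition bad_line_at N j i : {set {ffun 'I_k.+1 -> 'I_N}} :=
  [set u : {ffun 'I_k.+1 -> 'I_N} | `[< exists2 s : R, 0 <= s <= N%:R &
    `|c i - gridpt (fun l => if l == j then s else (u l)%:R)| <= r i >]]%SET.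

Definition bad_line N j : {set {ffun 'I_k.+1 -> 'I_N}} :=
  (\bigcup_i bad_line_at N j i)%SET.

Lemma gridpt_dist t N : (forall l, 0 <= t l <= N%:R) ->
  `|x - gridpt t| <= eta * (k.+1 * N)%:R.
Proof.
move=> tN; rewrite /gridpt opprD addNKr normrN normrZ gtr0_norm //.
rewrite ler_pM2l // natrM; apply: norm_lincomb_le => // l.
by have /andP[t0 tl] := tN l; rewrite ger0_norm.
Qed.

Lemma gridpt_segment t t' s : gridpt t + s *: (gridpt t' - gridpt t) =
  gridpt (fun l => t l + s * (t' l - t l)).
Proof.
rewrite /gridpt [x + eta *: lincomb e t']addrC addrKA -addrA -scalerBr.
rewrite scalerA mulrC -scalerA -scalerDr.
by rewrite -lincombB -[s *: _]lincombZ -lincombD.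
Qed.

Lemma gridpt_coord t t' l :
  `|t l - t' l| <= 3 ^+ k.+1 * (`|gridpt t - gridpt t'| / eta).
Proof.
apply: le_trans (eA (fun l => t l - t' l) l) _.
rewrite lincombB ler_wpM2l ?exprn_ge0 // ler_pdivlMr // mulrC.
by rewrite -{1}(gtr0_norm eta0) -normrZ scalerBr /gridpt [x + _]addrC addrKA.
Qed.

(** Two points of the same ball have coordinates that differ by at most the
    multiple 2 * 3^(k+1) of its radius; the 5 absorbs the rounding up. *)
Lemma card_bad_line_at N j i :
  #|bad_line_at N j i|%:R <= N%:R * (5 * 3 ^+ k.+1 * (r i / eta)) ^+ k :> R.
Proof.
set y := r i / eta; have y1 : 1 <= y by rewrite ler_pdivlMr // mul1r.
have p3 : 1 <= 3 ^+ k.+1 :> R by rewrite exprn_ege1 // ler1n.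
pose z : R := 2 * 3 ^+ k.+1 * y.
have py : 1 <= 3 ^+ k.+1 * y by rewrite mulr_ege1.
have z0 : 0 <= z by rewrite /z -mulrA; lra.
pose D := Num.truncn z.
have := @card_grid_line k.+1 N D j (bad_line_at N j i).
rewrite -(ler_nat R) natrM natrX => h; apply: le_trans (h _) _.
  move=> u u' l; rewrite !inE => -[s _ h1] [s' _ h2] lj.
  apply: leq_add_truncn; have := gridpt_coord
    (fun l => if l == j then s else (u l)%:R)
    (fun l => if l == j then s' else (u' l)%:R) l.
  rewrite (negbTE lj) => /le_trans; apply.
  rewrite /z [2 * _]mulrC -mulrA ler_wpM2l ?exprn_ge0 // mulrA ler_wpM2r //.
    by rewrite invr_ge0 ltW.
  rewrite -[X in `|X|](subrKA (c i)); apply: le_trans (ler_normD _ _) _.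
  by rewrite distrC; lra.
rewrite ler_wpM2l // lerXn2r ?nnegrE //; first by rewrite -mulrA; lra.
have := truncn_le z; rewrite z0 -/D natrD natrM /z -!mulrA; lra.
Qed.

(** Only the balls that meet B(x, rho) count, rho bounding the distance from
    x to the points of the cube.  Sparseness gives r_i <= rho for them, hence
    (r_i / rho)^k <= (r_i / rho)^m, which turns the number of bad lines into the
    mass that sparseness bounds. *)
Lemma few_bad_lines N : (0 < N)%N ->
  (2 ^ k.+3 * \sum_j #|bad_line N j| <= N ^ k.+1)%N.
Proof.
move=> N0; pose rho : R := eta * (k.+1 * N)%:R.
have rho0 : 0 < rho by rewrite mulr_gt0 // ltr0n muln_gt0.
pose P i := `|x - c i| <= rho + r i.
have r0 i : 0 < r i by apply: lt_le_trans eta0 (eta_r i).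
have empty j i : ~~ P i -> bad_line_at N j i = finset.set0.
  move=> nP; apply/setP => u; rewrite !inE; apply/asboolP => -[s sN h].
  case/negP: nP; rewrite /P; set p := gridpt _ in h.
  rewrite -(subrKA p); apply: le_trans (ler_normD _ _) _.
  rewrite lerD //; last by rewrite distrC.
  apply: gridpt_dist => l; case: ifP => // _.
  by rewrite ler0n ler_nat ltnW.
have small i : P i -> (r i / rho) ^+ k <= r i `^ m / rho `^ m.
  move=> Pi; have [ri0 rho_ge0] := (ltW (r0 i), ltW rho0).
  have ri : r i <= rho.
    have : r i `^ m <= rho `^ m.
      apply: (@le_trans _ _ (\sum_(i | P i) r i `^ m)).
        by rewrite (bigD1 i) //= lerDl sumr_ge0 // => *; rewrite powR_ge0.
      apply: le_trans (sparse rho0) _.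
      by rewrite ler_piMl ?powR_ge0 ?sparseness_le1.
    apply: contraTT; rewrite -!ltNge => lt.
    by apply: gt0_ltr_powR; rewrite // nnegrE ltW.
  rewrite -powR_mulrn ?divr_ge0 //.
  rewrite ler_pdivlMr ?powR_gt0 //.
  rewrite -[X in _ <= X `^ m](divfK (lt0r_neq0 rho0)).
  rewrite [leRHS]powRM ?divr_ge0 // ler_wpM2r ?powR_ge0 //.
  by apply: ger_powR => //; rewrite divr_gt0 //= ler_pdivrMr // mul1r.
pose C : R := (5 * 3 ^+ k.+1 * k.+1%:R) ^+ k.
have NC0 : 0 <= N%:R ^+ k.+1 * C.
  by rewrite mulr_ge0 // exprn_ge0 // !mulr_ge0 // exprn_ge0.
have one j : #|bad_line N j|%:R <= N%:R ^+ k.+1 * C * sparseness R k.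
  apply: (@le_trans _ _ (\sum_(i | P i) #|bad_line_at N j i|%:R)).
    rewrite -natr_sum ler_nat /bad_line (bigID P) /= finset.setUC.
    rewrite big1 ?finset.set0U; last by move=> i; exact: empty.
    elim/big_rec2: _ => [|i y A _ le]; first by rewrite cards0.
    exact: leq_trans (leq_card_setU _ _) (leq_add _ _).
  apply: (@le_trans _ _
      (\sum_(i | P i) N%:R ^+ k.+1 * C * (r i `^ m / rho `^ m))).
    apply: ler_sum => i Pi; apply: le_trans (card_bad_line_at N j i) _.
    rewrite (_ : N%:R * _ = N%:R ^+ k.+1 * C * (r i / rho) ^+ k); last first.
      rewrite (exprS N%:R) -mulrA -[RHS]mulrA -[in RHS]mulrA.
      rewrite -!exprMn; congr (_ * _ ^+ k); rewrite /rho natrM.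
      by field; rewrite [1 + _]addrC natr1 !pnatr_eq0 -lt0n N0 (gt_eqF eta0).
    by rewrite ler_wpM2l ?small.
  rewrite -mulr_sumr -mulr_suml ler_wpM2l //.
  by rewrite ler_pdivrMr ?powR_gt0 // sparse.
rewrite -(ler_nat R) natrM natr_sum !natrX.
apply: (@le_trans _ _
    (2 ^+ k.+3 * \sum_(j < k.+1) (N%:R ^+ k.+1 * C * sparseness R k))).
  by rewrite ler_wpM2l ?exprn_ge0 // ler_sum.
rewrite sumr_const card_ord -[_ *+ k.+1]mulr_natl /sparseness -/C.
have C0 : C != 0 by rewrite expf_neq0 // !mulf_neq0 // expf_neq0.
have q0 : 2 ^+ k.+3 != 0 :> R by rewrite expf_neq0.
have k0 : k.+1%:R != 0 :> R by [].
move: (2 ^+ k.+3) (k.+1%:R : R) (N%:R ^+ k.+1) C0 q0 k0 => q K NN C0 q0 K0.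
rewrite (_ : q * _ = NN) //; field.
by rewrite C0 q0 K0.
Qed.

End Grid.

(** If x saw a sparse covering at all scales, then U would contain half of the
    grid points of every dyadic cube at x.  But U is bounded, so that its grid
    points lie on a number of lines that does not depend on the cube. *)
Lemma trapped_point_density (R : realType) (B : normedModType R) (n : nat)
    (dimB : Vector.axiom n.+1 B) (k : nat) (m : R) (I : finType)
    (c : I -> B) (r : I -> R) (M U : set B) (x : B) :
  0 < m -> m <= k%:R -> (k <= n)%N -> (forall i, 0 < r i) ->
  M `<=` \bigcup_i closed_ball_ Num.norm (c i) (r i) ->
  is_component (~` M) U -> bounded_set U -> U x ->
  exists2 rho, 0 < rho & sparseness R k * rho `^ m <
    \sum_(i | `|x - c i| <= rho + r i) r i `^ m.
Proof.
move=> m0 mk kn r0 Mcov Ucomp Ubd Ux; apply: contrapT => dense.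
have sparse rho : 0 < rho ->
    \sum_(i | `|x - c i| <= rho + r i) r i `^ m <= sparseness R k * rho `^ m.
  move=> rho0; rewrite leNgt; apply/negP => lt; apply: dense; by exists rho.
have k0 : (0 < k)%N by rewrite -(ltr_nat R); apply: lt_le_trans mk.
have [e e1 eA] := frame_exists dimB (kn : k.+1 <= n.+1)%N.
pose eta : R := \big[Num.min/1]_i r i.
have eta0 : 0 < eta by apply: lt_bigmin.
have eta_r i : eta <= r i by exact: bigmin_le.
pose pt N (z : {ffun 'I_k.+1 -> 'I_N}) := gridpt e x eta (fun l => (z l)%:R).
pose G N := [set z : {ffun 'I_k.+1 -> 'I_N} | `[< U (pt N z) >]]%SET.
have Gcl N j (u v : {ffun 'I_k.+1 -> 'I_N}) : u \in G N ->
    u \notin bad_line c r e x eta N j ->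
    (forall l, l != j -> v l = u l) -> v \in G N.
  rewrite !inE => Uu ubad uv; apply: (component_segment Ucomp Uu) => s s01.
  rewrite gridpt_segment => /Mcov[i _ Bi]; case/negP: ubad.
  apply/bigcupP; exists i => //; rewrite !inE.
  exists ((u j)%:R + s * ((v j)%:R - (u j)%:R)).
    have : (u j)%:R <= N%:R :> R by rewrite ler_nat ltnW.
    have : (v j)%:R <= N%:R :> R by rewrite ler_nat ltnW.
    have : 0 <= (u j)%:R :> R by []. have : 0 <= (v j)%:R :> R by [].
    by move: s01; nra.
  rewrite (_ : (fun l => _) = fun l => (u l)%:R + s * ((v l)%:R - (u l)%:R)) //.
  apply/funext => l; have [->//|lj] := eqVneq l j.
  by rewrite uv // subrr mulr0 addr0.
have major s : ((2 ^ s) ^ k.+1 <= 2 * #|G (2 ^ s)|)%N.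
  elim: s => [|s IH].
    rewrite expn0 exp1n muln_gt0 /= card_gt0; apply/set0Pn.
    exists [ffun=> ord0]; rewrite inE /pt /gridpt.
    rewrite (_ : lincomb _ _ = 0) ?scaler0 ?addr0; first exact/asboolP.
    by rewrite /lincomb big1 // => l _; rewrite ffunE scale0r.
  have := @majority_propagates k.+1 (2 ^ s.+1) (G (2 ^ s.+1)%N) _ (Gcl _).
  apply; first by apply: (few_bad_lines m0); rewrite ?expn_gt0.
  rewrite [(2 ^ s.+1)%N]expnS expnMn [(2 ^ k.+2)%N]expnS [(2 * _)%N]mulnC.
  rewrite -mulnA leq_mul2l.
  apply/orP; right; apply: leq_trans IH _; rewrite leq_mul2l /= -expnS.
  have ss : (2 ^ s <= 2 ^ s.+1)%N by rewrite leq_exp2l.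
  apply: (card_grid_widen (NN' := ss)) => z; rewrite !inE.
  by rewrite /pt; congr (U (gridpt _ _ _ _)); apply/funext => l; rewrite ffunE.
have [b bP] : exists b, forall y, U y -> `|y| <= b.
  by have [b _ bP] := ex_strict_bound_gt0 Ubd; exists b => y /bP /ltW.
pose K := Num.truncn (3 ^+ k.+1 * (2 * b / eta)).
have minor N : (#|G N| <= N * (2 * K + 1) ^ k)%N.
  apply: (card_grid_line (j := ord0)) => u u' l; rewrite !inE => Uu Uu' _.
  apply: leq_add_truncn; apply: le_trans (gridpt_coord x eta0 eA
    (fun l => (u l)%:R) (fun l => (u' l)%:R) l) _.
  rewrite ler_wpM2l ?exprn_ge0 // ler_wpM2r ?invr_ge0 ?(ltW eta0) //.
  apply: le_trans (ler_normB _ _) _; have := bP _ Uu; have := bP _ Uu'.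
  rewrite /pt; lra.
(* The side N = 2 ^ Y exceeds Y, but the two bounds give N ^ k <= Y ^ k. *)
pose Y := (2 * (2 * K + 1))%N.
have /leq_trans/(_ (leq_mul (leqnn 2) (minor _))) := major Y.
rewrite expnS mulnCA leq_pmul2l ?expn_gt0 //.
apply/negP; rewrite -ltnNge.
apply: (@leq_ltn_trans (Y ^ k)); last by rewrite ltn_exp2r // ltn_expl.
have k2 : (2 <= 2 ^ k)%N by rewrite -[leqLHS]expn1 leq_exp2l.
by rewrite expnMn leq_mul2r k2 orbT.
Qed.

(** * The boxing inequality *)
Lemma powRK (R : realType) (p x : R) : 0 < p -> 0 <= x ->
  (x `^ p) `^ p^-1 = x.
Proof. by move=> p0 x0; rewrite -powRrM mulfV ?gt_eqF // powRr1. Qed.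

Lemma powRVK (R : realType) (p x : R) : 0 < p -> 0 <= x ->
  (x `^ p^-1) `^ p = x.
Proof. by move=> p0 x0; rewrite -powRrM mulVf ?gt_eqF // powRr1. Qed.

Definition covers (R : realType) (B : normedModType R) (s : seq (B * R))
    (V : set B) :=
  forall y, V y -> exists2 p, p \in s & `|p.1 - y| <= p.2.

(** Vitali's selection, organized by the finite set I of indices: a point x of
    nearly maximal radius pays for its ball with the weights of J x; all points
    y such that J y meets J x lie in the ball enlarged 5 times, and the other
    points use indices that have not been spent. *)
Lemma greedy_ball_cover (R : realType) (B : normedModType R) (I : finType)
    (w : I -> R) (m eps : R) (V : set B) (rho : B -> R) (J : B -> {set I}) :
  0 < m -> 0 < eps -> (forall i, 0 <= w i) ->
  (forall x, V x -> 0 < rho x) ->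
  (forall x, V x -> eps * rho x `^ m <= \sum_(i in J x) w i) ->
  (forall x y i, V x -> V y -> i \in J x -> i \in J y -> rho y <= 2 * rho x ->
     `|x - y| <= 5 * rho x) ->
  forall S : {set I}, exists s : seq (B * R),
    [/\ forall p, p \in s -> 0 <= p.2,
        covers s [set y | V y /\ J y \subset S] &
        \sum_(p <- s) p.2 `^ m <= 5 `^ m / eps * \sum_(i in S) w i].
Proof.
move=> m0 eps0 w0 rho0 rhoJ near S.
have [N] := ubnP #|S|; elim: N S => // N IH S SN.
have [[x0 [Vx0 Jx0]]|none] := pselect (exists y, V y /\ J y \subset S);
  last first.
  exists [::]; split => //.
    by move=> y h; case: none; exists y.
  by rewrite big_nil mulr_ge0 ?divr_ge0 ?powR_ge0 ?sumr_ge0 // ltW.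
pose T := [set rho y | y in [set y | V y /\ J y \subset S]].
have rho_le y : V y -> J y \subset S ->
    rho y <= ((\sum_(i in S) w i) / eps) `^ m^-1.
  move=> Vy JS; have ry := ltW (rho0 _ Vy).
  rewrite -(powRK m0 ry).
  apply: ge0_ler_powR; rewrite ?invr_ge0 ?(ltW m0) ?nnegrE ?powR_ge0 //.
    by rewrite divr_ge0 ?sumr_ge0 // ltW.
  rewrite ler_pdivlMr // mulrC; apply: le_trans (rhoJ _ Vy) _.
  rewrite [leRHS](big_setID (J y)) /= (finset.setIidPr JS) lerDl.
  by rewrite sumr_ge0.
have Tsup : has_sup T.
  split; first by exists (rho x0), x0.
  exists (((\sum_(i in S) w i) / eps) `^ m^-1) => _ [y [Vy JS] <-].
  exact: rho_le.
have supT0 : 0 < sup T.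
  by apply: lt_le_trans (rho0 _ Vx0) _; apply: (ub_le_sup Tsup.2); exists x0.
have [_ [x [Vx JxS] <-] xbig] := sup_adherent (divr_gt0 supT0 (ltr0n _ 2)) Tsup.
have xmax y : V y -> J y \subset S -> rho y <= 2 * rho x.
  move=> Vy JS; have : rho y <= sup T by apply: (ub_le_sup Tsup.2); exists y.
  by move: xbig; lra.
have Jx_ne : J x != finset.set0.
  apply/eqP => J0; have := rhoJ _ Vx; rewrite J0 big_set0 leNgt.
  by rewrite mulr_gt0 // powR_gt0 ?rho0.
have [s [s0 scov ssum]] : exists s : seq (B * R),
    [/\ forall p, p \in s -> 0 <= p.2,
        covers s [set y | V y /\ J y \subset S :\: J x] &
        \sum_(p <- s) p.2 `^ m <= 5 `^ m / eps * \sum_(i in S :\: J x) w i].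
  apply: IH; apply: (@leq_trans #|S|); last by rewrite -ltnS.
  rewrite -(cardsID (J x) S) (finset.setIidPr JxS) -[ltnLHS]add0n ltn_add2r.
  by rewrite card_gt0.
exists ((x, 5 * rho x) :: s); split.
- move=> p; rewrite inE => /predU1P[->|/s0 //] /=.
  by rewrite mulr_ge0 // ltW // rho0.
- move=> y [Vy JyS].
  have [disj|[i /finset.setIP[iy ix]]] := set_0Vmem (J y :&: J x).
    have [|p ps py] := scov y.
      by split=> //; rewrite finset.subsetD JyS -finset.setI_eq0; apply/eqP.
    by exists p => //; rewrite inE ps orbT.
  exists (x, 5 * rho x); first by rewrite inE eqxx.
  by apply: (near x y i) => //; exact: xmax.
rewrite big_cons /= (big_setID (J x)) /= (finset.setIidPr JxS) mulrDr lerD //.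
rewrite powRM ?(ltW (rho0 _ Vx)) // -mulrA ler_wpM2l ?powR_ge0 //.
by rewrite mulrC ler_pdivlMr // mulrC rhoJ.
Qed.

(** If x lies in no B(c_i, 2 r_i), then the balls of the covering that meet
    B(x, rho) have radius less than rho, so that the selection applies. *)
Lemma boxing (R : realType) (B : normedModType R) (n : nat)
    (dimB : Vector.axiom n.+1 B) (k : nat) (m : R) (I : finType)
    (c : I -> B) (r : I -> R) (M U : set B) :
  0 < m -> m <= k%:R -> (k <= n)%N -> (forall i, 0 < r i) ->
  M `<=` \bigcup_i closed_ball_ Num.norm (c i) (r i) ->
  is_component (~` M) U -> bounded_set U ->
  exists s : seq (B * R), [/\ forall p, p \in s -> 0 <= p.2, covers s U &
    \sum_(p <- s) p.2 `^ m <=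
      (2 `^ m + 5 `^ m / sparseness R k) * \sum_i r i `^ m].
Proof.
move=> m0 mk kn r0 Mcov Ucomp Ubd.
have /choice[rho rhoP] x : exists rho, U x -> 0 < rho /\
    sparseness R k * rho `^ m < \sum_(i | `|x - c i| <= rho + r i) r i `^ m.
  have [Ux|] := pselect (U x); last by exists 0.
  have [rho ? ?] := trapped_point_density dimB m0 mk kn r0 Mcov Ucomp Ubd Ux.
  by exists rho.
pose V := [set x | U x /\ forall i, 2 * r i < `|c i - x|].
pose J x : {set I} := [set i | `|x - c i| <= rho x + r i]%SET.
have small x i : V x -> i \in J x -> r i < rho x.
  by move=> [_ /(_ i)]; rewrite inE distrC; lra.
have [||||s [s0 scov ssum]] := @greedy_ball_cover R B I (fun i => r i `^ m) m
    (sparseness R k) V rho J m0 (sparseness_gt0 R k) _ _ _ _ [set: I]%SET.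
- by move=> i; exact: powR_ge0.
- by move=> x [/rhoP[]].
- move=> x [/rhoP[_ /ltW h] _]; apply: le_trans h _.
  rewrite le_eqVlt; apply/orP; left; apply/eqP.
  by apply: eq_bigl => i; rewrite inE.
- move=> x y i Vx Vy ix iy xy; have := small _ _ Vx ix.
  move: ix iy; rewrite !inE => ix iy rx.
  rewrite -(subrKA (c i)); apply: le_trans (ler_normD _ _) _.
  by rewrite (distrC (c i)); lra.
exists ([seq (c i, 2 * r i) | i <- enum I] ++ s); split.
- move=> p; rewrite mem_cat => /orP[/mapP[i _ ->] /=|/s0 //].
  by rewrite mulr_ge0 // ltW.
- move=> y Uy; have [[i iy]|far] := pselect (exists i, `|c i - y| <= 2 * r i).
    exists (c i, 2 * r i) => //; rewrite mem_cat; apply/orP; left.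
    by apply/mapP; exists i; rewrite ?mem_enum.
  have [|p ps py] := scov y.
    split; last by rewrite finset.subsetT.
    by split=> // i; rewrite ltNge; apply/negP => h; apply: far; exists i.
  by exists p => //; rewrite mem_cat ps orbT.
rewrite big_cat big_map big_enum /= mulrDl lerD //; last first.
  by apply: le_trans ssum _; rewrite big_set.
rewrite mulr_sumr ler_sum // => i _.
by rewrite powRM // ltW.
Qed.

(** * Hausdorff contents *)

(** Each term f p is at most t^(1/m), and f p^(m+1) = f p^m * f p. *)
Lemma sum_powR_add1_le (R : realType) (T : eqType) (s : seq T) (f : T -> R)
    (m t : R) :
  0 < m -> (forall p, p \in s -> 0 <= f p) ->
  \sum_(p <- s) f p `^ m <= t ->
  \sum_(p <- s) f p `^ (m + 1) <= t `^ ((m + 1) / m).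
Proof.
move=> m0 f0 st.
have t0 : 0 <= t.
  by apply: le_trans st; rewrite sumr_ge0 // => *; rewrite powR_ge0.
have m1 : m + 1 != 0 by rewrite gt_eqF // addr_gt0.
have -> : t `^ ((m + 1) / m) = t * t `^ m^-1.
  rewrite mulrDl divff ?gt_eqF // mul1r powRD ?powRr1 //.
  by apply/implyP; rewrite gt_eqF // addr_gt0 // invr_gt0.
apply: le_trans (ler_wpM2r (powR_ge0 _ _) st).
rewrite mulr_suml !big_seq; apply: ler_sum => p ps.
rewrite powRD ?(negPf m1) // powRr1 ?f0 // ler_wpM2l ?powR_ge0 //.
rewrite -[leLHS](powRK m0) ?f0 //.
apply: ge0_ler_powR; rewrite ?invr_ge0 ?(ltW m0) ?nnegrE ?powR_ge0 //.
apply: le_trans st; rewrite (big_rem p) //= lerDl.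
by rewrite sumr_ge0 // => *; rewrite powR_ge0.
Qed.

(** A finite union of closed balls is closed, so it covers the closure as soon
    as it covers the set. *)
Lemma content_closure_le (R : realType) (B : normedModType R) (m : R)
    (s : seq (B * R)) (V : set B) :
  m != 0 -> (forall p, p \in s -> 0 <= p.2) -> covers s V ->
  (hausdorff_content m (closure V) <= (\sum_(p <- s) p.2 `^ m)%:E)%E.
Proof.
move=> m0 s0 sV; apply: ereal_inf_lbound.
pose z : B * R := (0, 0).
exists (fun i => (nth z s i).1), (fun i => (nth z s i).2); split.
- move=> i; have [si|si] := ltnP i (size s); last by rewrite nth_default.
  exact/s0/mem_nth.
- have sub : V `<=` \bigcup_(i in `I_(size s))
      closed_ball_ Num.norm (nth z s i).1 (nth z s i).2.
    move=> y /sV[p ps py]; exists (index p s); first by rewrite /= index_mem.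
    by rewrite nth_index.
  apply: (@subset_trans _ (\bigcup_(i in `I_(size s))
      closed_ball_ Num.norm (nth z s i).1 (nth z s i).2)); last first.
    by move=> y [i _ iy]; exists i.
  have /closure_id -> : closed (\bigcup_(i in `I_(size s))
      closed_ball_ Num.norm (nth z s i).1 (nth z s i).2).
    by apply: closed_bigcup => // i _; exact: closed_closed_ball_.
  exact: closure_subset.
rewrite (nneseries_split 0 (size s)).
  2: by move=> i _; rewrite lee_fin powR_ge0.
rewrite add0n [X in (_ + X)%E]eseries0 ?adde0; last first.
  by move=> i si _; rewrite nth_default //= powR0.
by rewrite sumEFin (big_nth z).
Qed.

(** The r_i^m are increased by the terms of a geometric series, which makes the
    radii positive and lets the open balls cover M. *)
Lemma finite_ball_cover (R : realType) (B : normedModType R) (m t : R)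
    (M : set B) :
  0 < m -> compact M -> (hausdorff_content m M < t%:E)%E ->
  exists N (c : 'I_N -> B) (r : 'I_N -> R),
    [/\ forall i, 0 < r i, M `<=` \bigcup_i closed_ball_ Num.norm (c i) (r i) &
        \sum_i r i `^ m <= t].
Proof.
move=> m0 Mc /ereal_inf_lt[_ [c [r [r0 Mcov ->]]]].
set S := (\sum_(0 <= i <oo) _)%E => St.
have S0 : (0 <= S)%E by apply: nneseries_ge0 => i _ _; rewrite lee_fin powR_ge0.
have Sfin : S \is a fin_num by rewrite ge0_fin_numE // (lt_trans St) ?ltry.
pose del := t - fine S.
have del0 : 0 < del by rewrite subr_gt0 -lte_fin fineK.
pose w i := del / (2 ^ i.+1)%:R.
have w0 i : 0 < w i by rewrite divr_gt0 // ltr0n expn_gt0.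
pose q i := (r i `^ m + w i) `^ m^-1.
have qm i : q i `^ m = r i `^ m + w i.
  by rewrite powRVK // addr_ge0 ?powR_ge0 // ltW.
have q0 i : 0 < q i by rewrite powR_gt0 // ltr_wpDl ?powR_ge0.
have rq i : r i < q i.
  rewrite ltNge; apply/negP => qr.
  have := ge0_ler_powR (ltW m0) _ _ qr; rewrite !nnegrE qm.
  move=> /(_ (ltW (q0 i)) (r0 i)).
  by rewrite gerDl leNgt w0.
move: Mc; rewrite compact_cover => /(_ nat setT (fun i => ball (c i) (q i))).
case.
- by move=> i _; exact: ball_open.
- move=> y /Mcov[i _ /= iy]; exists i => //.
  by rewrite -ball_normE /ball_ /=; apply: le_lt_trans iy _.
move=> D _ MD.
pose N := (\max_(i <- finmap.enum_fset D) i).+1.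
exists N, (fun i => c i), (fun i => q i); split => //.
- move=> y /MD[i iD]; rewrite -ball_normE /ball_ /= => iy.
  have iN : (i < N)%N.
    by rewrite ltnS; exact: (@leq_bigmax_seq _ _ xpredT (fun j => j)).
  by exists (Ordinal iN) => //=; exact: ltW.
under eq_bigr do rewrite qm.
rewrite -lee_fin -[t](subrK (fine S)) addrC -/del EFinD fineK //.
have A0 i : (0 <= (r i `^ m)%:E)%E by rewrite lee_fin powR_ge0.
have B0 i : (0 <= (r i `^ m)%:E + (w i)%:E)%E.
  by rewrite adde_ge0 // lee_fin ltW.
apply: (le_trans _ (epsilon_trick xpredT A0 (ltW del0))).
apply: (le_trans _ (nneseries_lim_ge N (fun i _ _ => B0 i))).
by rewrite -(big_mkord xpredT (fun i => r i `^ m + w i)) -sumEFin.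
Qed.

(** A grid of mesh a / K uses about K^n balls of radius comparable to 1 / K, and
    K^n K^-q tends to 0. *)
Lemma bounded_null_cover (R : realType) (B : normedModType R) (n : nat)
    (dimB : Vector.axiom n B) (q eps : R) (V : set B) :
  n%:R < q -> bounded_set V -> 0 < eps ->
  exists s : seq (B * R), [/\ forall p, p \in s -> 0 <= p.2, covers s V &
    \sum_(p <- s) p.2 `^ q <= eps].
Proof.
move=> nq /ex_strict_bound_gt0[b b0 bV] eps0.
have [e e1 eA] := frame_exists dimB (leqnn n).
pose a : R := 3 ^+ n * b; have a0 : 0 < a by rewrite mulr_gt0 // exprn_gt0.
pose C : R := 3 ^+ n * (n%:R * a) `^ q.
have C0 : 0 <= C by rewrite mulr_ge0 ?powR_ge0 // exprn_ge0.
have qn0 : 0 < q - n%:R by rewrite subr_gt0.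
pose K := (Num.truncn ((C / eps) `^ (q - n%:R)^-1)).+1.
have K0 : 0 < K%:R :> R by [].
have K1 : 1 <= K%:R :> R by rewrite ler1n.
have KC : C / eps <= K%:R `^ (q - n%:R).
  have Ce : 0 <= C / eps by rewrite divr_ge0 // ltW.
  rewrite -[leLHS](powRVK qn0) //.
  apply: ge0_ler_powR; rewrite ?nnegrE ?powR_ge0 ?(ltW qn0) //.
  by rewrite ltW // -truncn_lt_nat ?powR_ge0.
pose delta := a / K%:R.
have delta0 : 0 < delta by rewrite divr_gt0.
pose ctr (z : {ffun 'I_n -> 'I_(2 * K).+1}) :=
  lincomb e (fun l => (z l)%:R * delta - a).
exists [seq (ctr z, n%:R * delta) | z <- enum {: {ffun 'I_n -> 'I_(2 * K).+1}}].
split.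
- by move=> p /mapP[z _ ->] /=; rewrite mulr_ge0 // ltW.
- move=> y Vy; have [t yE] := frame_spans dimB eA y.
  have ta l : `|t l| <= a.
    apply: le_trans (eA t l) _; rewrite ler_wpM2l ?exprn_ge0 // -yE.
    exact/ltW/bV.
  pose v l := (t l + a) / delta.
  have v0 l : 0 <= v l.
    by rewrite divr_ge0 ?(ltW delta0) //; have := ta l; rewrite ler_norml; lra.
  have vK l : (Num.truncn (v l) < (2 * K).+1)%N.
    rewrite truncn_lt_nat // -natr1 natrM.
    apply: (@le_lt_trans _ _ (2 * K%:R)); last by rewrite ltrDl.
    rewrite /v ler_pdivrMr // /delta mulrA -[2 * _ * a]mulrA [K%:R * a]mulrC.
    rewrite mulrA mulfK ?gt_eqF //; have := ta l; rewrite ler_norml; lra.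
  pose z := [ffun l => Ordinal (vK l)].
  exists (ctr z, n%:R * delta).
    by apply/mapP; exists z; rewrite ?mem_enum.
  rewrite /= yE -lincombB; apply: norm_lincomb_le => // l; rewrite ffunE /=.
  have -> : (Num.truncn (v l))%:R * delta - a - t l =
      ((Num.truncn (v l))%:R - v l) * delta.
    by rewrite mulrBl /v divfK ?gt_eqF // opprD addrA addrAC.
  rewrite normrM (gtr0_norm delta0) ler_piMl ?(ltW delta0) // ler_norml.
  have /andP[] := truncn_itv (v0 l); rewrite -natr1; lra.
rewrite big_map big_enum /= sumr_const card_ffun !card_ord.
rewrite -[_ *+ (_ ^ _)%N]mulr_natl natrX.
rewrite /delta mulrA powRM ?mulr_ge0 ?invr_ge0 ?(ltW b0) //.
have KqE : K%:R^-1 `^ q = (K%:R ^+ n * K%:R `^ (q - n%:R))^-1 :> R.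
  rewrite -powR_inv1 // -powRrM mulN1r powRN -powR_mulrn // -powRD.
    by rewrite addrC subrK.
  by rewrite (gt_eqF K0) implybT.
apply: (@le_trans _ _ ((3 * K%:R) ^+ n * ((n%:R * a) `^ q * K%:R^-1 `^ q))).
  rewrite ler_wpM2r ?mulr_ge0 ?powR_ge0 // lerXn2r ?nnegrE //.
  by rewrite -natr1 natrM; lra.
have Kq0 : 0 < K%:R `^ (q - n%:R) by rewrite powR_gt0.
have Kn0 : 0 < K%:R ^+ n :> R by rewrite exprn_gt0.
rewrite KqE exprMn (_ : _ * _ = C / K%:R `^ (q - n%:R)).
  by rewrite ler_pdivrMr // mulrC -ler_pdivrMr.
by rewrite /C; field; rewrite ?gt_eqF.
Qed.

(** * The isoperimetric inequality *)
Theorem corollary1p2 (R : realType) (m : R) (hm : 0 < m) :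
  exists const : R,
    forall (n : nat) (B : completeNormedModType R)
      (dimB : Vector.axiom n.+1 B) (M : set B),
      compact M -> connected M -> topological_submanifold R n M ->
      forall U : set B, is_component (~` M) U -> bounded_set U ->
        (hausdorff_content (m + 1) (closure U) <=
         const%:E * poweR (hausdorff_content m M) ((m + 1) / m))%E.
Proof.
have [k mk kmin] : exists2 k, m <= k%:R & forall j, m <= j%:R -> (k <= j)%N.
  have exk : exists k, m <= k%:R.
    by exists (Num.truncn m).+1; rewrite ltW // -truncn_lt_nat // ltW.
  by have [k] := ex_minnP exk; exists k.
pose C : R := 2 `^ m + 5 `^ m / sparseness R k.
have C0 : 0 < C by rewrite addr_gt0 ?divr_gt0 ?powR_gt0 ?sparseness_gt0.
pose p := (m + 1) / m; have p0 : 0 < p by rewrite divr_gt0 ?addr_gt0.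
have Cp0 : 0 < C `^ p by rewrite powR_gt0.
have m1 : m + 1 != 0 by rewrite gt_eqF ?addr_gt0.
exists (C `^ p) => n B dimB M Mc _ _ U Ucomp Ubd; rewrite -/p.
have [kn|nk] := leqP k n; last first.
  apply: (@le_trans _ _ 0%E).
    2: by rewrite mule_ge0 ?poweR_ge0 // lee_fin ltW.
  apply/lee_addgt0Pr => eps eps0; rewrite add0e.
  have nm : n.+1%:R < m + 1.
    rewrite -natr1 ltrD2r ltNge; apply: contraL nk => mn.
    by rewrite -leqNgt kmin.
  have [s [s0 scov ssum]] := bounded_null_cover dimB nm Ubd eps0.
  by apply: le_trans (content_closure_le m1 s0 scov) _; rewrite lee_fin.
(* The estimate for all t above the content of M; the infimum over t
   is taken at the end, where t is chosen by strict monotonicity of powers. *)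
have filled t : (hausdorff_content m M < t%:E)%E ->
    (hausdorff_content (m + 1) (closure U) <= (C `^ p * t `^ p)%:E)%E.
  move=> Mt; have [N [c [r [r0 Mcov rsum]]]] := finite_ball_cover hm Mc Mt.
  have [s [s0 scov ssum]] := boxing dimB hm mk kn r0 Mcov Ucomp Ubd.
  apply: le_trans (content_closure_le m1 s0 scov) _; rewrite lee_fin.
  have t0 : 0 <= t.
    by apply: le_trans rsum; rewrite sumr_ge0 // => *; rewrite powR_ge0.
  rewrite -powRM ?(ltW C0) //; apply: sum_powR_add1_le => //.
  by apply: le_trans ssum _; rewrite ler_wpM2l // ltW.
have h0 : (0 <= hausdorff_content m M)%E.
  apply: le_ereal_inf_tmp => _ [c [r [_ _ ->]]].
  by apply: nneseries_ge0 => i _ _; rewrite lee_fin powR_ge0.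
case: (hausdorff_content m M) h0 filled => [h| |] //; last first.
  by move=> _ _; rewrite poweRyr ?gt_eqF // mulry gtr0_sg // mul1e leey.
rewrite lee_fin => h0 filled; rewrite poweR_EFin -EFinM.
rewrite leNgt; apply/negP.
case: (hausdorff_content _ _) filled => [x| |] // filled.
  rewrite lte_fin -ltr_pdivlMl // => hx.
  set y := _ * x in hx.
  have y0 : 0 < y by apply: le_lt_trans hx; rewrite powR_ge0.
  have hy : h < y `^ p^-1.
    rewrite -[h](powRK p0) //.
    by apply: gt0_ltr_powR; rewrite ?invr_gt0 ?nnegrE ?powR_ge0 ?(ltW y0).
  have /filled : (h%:E < ((h + y `^ p^-1) / 2)%:E)%E by rewrite lte_fin; lra.
  rewrite lee_fin leNgt => /negP; apply.
  rewrite mulrC -ltr_pdivlMr // [x / _]mulrC -/y.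
  rewrite -[ltRHS](powRVK p0) ?(ltW y0) //.
  by apply: gt0_ltr_powR; rewrite ?nnegrE ?powR_ge0 //; lra.
by move=> _; have := filled (h + 1); rewrite lte_fin ltrDl ltr01 => /(_ isT).
Qed.
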